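(* Let $G$ be a simple graph of order $n$ that contains no isolated vertices. Then $I_RE(G)\geq \sqrt{n}$, and equality holds if and only if $G\cong K_2$.
   Context: All graphs are simple and finite. For a graph $G$ with vertex set $V(G)=\{v_1,\dots,v_n\}$, edge set $E(G)=\{e_1,\dots,e_m\}$ and degrees $d_i=\deg(v_i)$, the Randić incidence matrix $I_R(G)$ is the $n\times m$ matrix whose $(i,j)$-entry is $d_i^{-1/2}$ if $v_i$ is incident to $e_j$ and $0$ otherwise. Its singular values $\sigma_1(G),\dots,\sigma_n(G)$ are the square roots of the eigenvalues of the $n\times n$ matrix $I_R(G)I_R(G)^T$, and the Randić incidence energy is $I_RE(G)=\sum_{i=1}^n\sigma_i(G)$. *)

(* Defs.v *)
From HB Require Import structures.
From mathcomp Require Import all_boot all_order all_algebra.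
From mathcomp Require Export polyrcf.

Set Implicit Arguments.
Unset Strict Implicit.
Unset Printing Implicit Defensive.

Import Order.TTheory GRing.Theory Num.Theory.
Local Open Scope ring_scope.

Record sgraph := SGraph {
  vertex :> finType;
  adj : rel vertex;
  adj_sym : symmetric adj;
  adj_irr : irreflexive adj }.

Definition edges (G : sgraph) : {set {set G}} :=
  [set [set p.1; p.2] | p : G * G & adj p.1 p.2].

Definition deg (G : sgraph) (v : G) : nat := #|[set w | adj v w]|.

Definition isolated (G : sgraph) (v : G) : bool := [forall w, ~~ adj v w].

Definition sg_iso (G H : sgraph) : Prop :=
  exists2 f : G -> H, bijective f & forall x y, adj (f x) (f y) = adj x y.

Section CompleteGraph.
Variable n : nat.

Let neq_sym : symmetric (fun x y : 'I_n => x != y).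
Proof. by move=> x y; rewrite eq_sym. Qed.

Let neq_irr : irreflexive (fun x y : 'I_n => x != y).
Proof. by move=> x; rewrite eqxx. Qed.

Definition complete_graph : sgraph := SGraph neq_sym neq_irr.

End CompleteGraph.

(* The labellings v_1, ..., v_n and e_1, ..., e_m are the canonical
   enumerations of the vertex set and of the edge set. *)
Definition randic_incidence (R : rcfType) (G : sgraph) :
    'M[R]_(#|G|, #|edges G|) :=
  \matrix_(i, j) (let v : G := enum_val i in let e : {set G} := enum_val j in
                   if v \in e then (Num.sqrt (deg v)%:R)^-1 else 0).

(* All the eigenvalues lying in R, in nondecreasing order, each one repeated
   according to its algebraic multiplicity; when A is symmetric there are
   exactly n of them, by the spectral theorem. *)
Definition eigenvalues (R : rcfType) (n : nat) (A : 'M[R]_n) : seq R :=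
  flatten [seq nseq (mup a (char_poly A)) a | a <- rootsR (char_poly A)].

Definition singular_values (R : rcfType) (m n : nat) (A : 'M[R]_(m, n)) :
    seq R :=
  [seq Num.sqrt a | a <- eigenvalues (A *m A^T)].

Definition randic_incidence_energy (R : rcfType) (G : sgraph) : R :=
  \sum_(s <- singular_values (randic_incidence R G)) s.

(* Main.v *)
(** Let B = I_R I_R^T, with eigenvalues l_i >= 0. If no vertex is isolated,
    B has unit diagonal, so sum l_i = tr B = n. For nonnegative numbers,
    sum x_i^2 <= (sum x_i)^2, with equality iff the products x_i x_j (i < j)
    all vanish. Taking x_i = sqrt l_i gives the bound n <= I_RE^2; taking
    x_i = l_i, which has the same equality case, shows that I_RE^2 = n iff
    tr B^2 = n^2. The entries of B lie in [0, 1], so this means that B is the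
    all-ones matrix, i.e. that G is complete with all degrees equal to 1. *)
Require Import Defs.
From mathcomp Require Import all_boot all_order all_algebra.
From mathcomp Require Import complex.

Set Implicit Arguments.
Unset Strict Implicit.
Unset Printing Implicit Defensive.

Import Order.TTheory GRing.Theory Num.Theory.
Local Open Scope ring_scope.

(** * Spectra of real symmetric matrices and of Gram matrices *)

Lemma char_poly_similar (F : comUnitRingType) (n : nat) (P A : 'M[F]_n) :
  P \in unitmx -> char_poly (invmx P *m A *m P) = char_poly A.
Proof.
move=> Pu; pose Q : 'M[{poly F}]_n := map_mx polyC P.
pose Q' : 'M[{poly F}]_n := map_mx polyC (invmx P).
have Q'Q : Q' *m Q = 1%:M by rewrite -map_mxM mulVmx // map_mx1.
have -> : char_poly (invmx P *m A *m P) = \det (Q' *m char_poly_mx A *m Q).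
  (* The scalar matrix of ['X] commutes with [Q], so conjugating it by [Q] leaves it unchanged. *)
  rewrite /char_poly /char_poly_mx mulmxBr mulmxBl !map_mxM.
  by rewrite scalar_mxC -!mulmxA Q'Q mulmx1.
by rewrite !det_mulmx mulrAC -det_mulmx Q'Q det1 mul1r.
Qed.

(** Over [R[i]] the matrix is hermitian, hence unitarily diagonalizable with real eigenvalues.
    Conjugation preserves the characteristic polynomial and the trace, and all three identities
    descend to [R] because [R] embeds injectively in [R[i]]. *)
Lemma symmetric_spectrum (R : rcfType) (n : nat) (A : 'M[R]_n) : A^T = A ->
  exists s : seq R, [/\ char_poly A = \prod_(a <- s) ('X - a%:P),
    \sum_(a <- s) a = \tr A & \sum_(a <- s) a ^+ 2 = \tr (A *m A)].
Proof.
move=> Asym; pose C : 'M[R[i]]_n := map_mx (real_complex R) A.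
have Creal : C \is a mxOver Num.real.
  by apply/mxOverP => i j; rewrite mxE; apply/complex_realP; exists (A i j).
have Csym : C \is symmetricmx.
  apply/is_hermitianmxP/matrixP => i j.
  by rewrite expr0 scale1r !mxE -[in LHS]Asym mxE.
have CH : C \is hermsymmx by exact: realsym_hermsym.
have /mxOverP dreal := hermitian_spectral_diag_real CH.
have /orthomx_spectralP := hermitian_normalmx CH.
have := spectral_unit C.
move: (spectralmx C) (spectral_diag C) dreal => P d dreal Pu CE.
(* The entries of [d] are complex numbers with zero imaginary part; [r] is the same row read in
   [R]. *)
pose r := map_mx (@complex.Re R) d.
have dE i : d 0 i = (r 0 i)%:C%C by rewrite mxE RRe_real.
have CC : C *m C = invmx P *m (diag_mx d *m diag_mx d) *m P.
  by rewrite CE !mulmxA mulmxK.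
have trC (M : 'M[R[i]]_n) : \tr (invmx P *m M *m P) = \tr M.
  by rewrite mxtrace_mulC mulmxA mulmxV // mul1mx.
exists (codom (r 0)); split.
- apply: (@map_poly_inj _ _ (real_complex R)).
  rewrite map_char_poly -/C CE char_poly_similar // char_poly_trig; last first.
    by rewrite diag_mx_is_trig.
  rewrite rmorph_prod big_map big_enum /=; apply: eq_bigr => i _.
  by rewrite mxE eqxx mulr1n dE rmorphB /= map_polyX map_polyC.
- apply: (@complexI R); rewrite raddf_sum big_map big_enum /=.
  rewrite -[RHS]trace_map_mx -/C CE trC mxtrace_diag.
  by apply: eq_bigr => i _; rewrite dE.
- apply: (@complexI R); rewrite raddf_sum big_map big_enum /=.
  rewrite -[RHS]trace_map_mx map_mxM -/C CC trC mulmx_diag mxtrace_diag.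
  by apply: eq_bigr => i _; rewrite [RHS]mxE dE rmorphXn expr2.
Qed.

(** [rootsR] lists each root once, and the multiplicity of a root in the split product is its number
    of occurrences in [s]. *)
Lemma perm_eigenvalues (R : rcfType) (n : nat) (A : 'M[R]_n) (s : seq R) :
  char_poly A = \prod_(a <- s) ('X - a%:P) -> perm_eq (eigenvalues A) s.
Proof.
move=> pA; have p_neq0 : char_poly A != 0.
  by rewrite monic_neq0 // char_poly_monic.
have rs : perm_eq (rootsR (char_poly A)) (undup s).
  apply: uniq_perm => [||a]; [exact: polyrcf.uniq_roots | exact: undup_uniq |].
  by rewrite mem_undup -(roots_on_rootsR p_neq0) pA root_prod_XsubC in_itv.
apply: perm_trans (perm_flatten (perm_map _ rs)) _.
apply: perm_trans (perm_count_undup s).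
by rewrite pA (eq_map (fun a => congr1 (nseq^~ a) (mu_prod_XsubC a s))).
Qed.

(** For a row eigenvector [v], [a] times the squared norm of [v] is the squared norm of [v *m A]. *)
Lemma gram_eigenvalue_ge0 (R : rcfType) (m n : nat) (A : 'M[R]_(m, n)) (a : R) :
  root (char_poly (A *m A^T)) a -> 0 <= a.
Proof.
rewrite -eigenvalue_root_char => /eigenvalueP[v vE v0].
have dotE k (u : 'rV[R]_k) : (u *m u^T) 0 0 = \sum_i u 0 i ^+ 2.
  by rewrite mxE; apply: eq_bigr => i _; rewrite mxE expr2.
have dot_ge0 k (u : 'rV[R]_k) : 0 <= (u *m u^T) 0 0.
  by rewrite dotE sumr_ge0 // => i _; rewrite sqr_ge0.
have v_gt0 : 0 < (v *m v^T) 0 0.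
  rewrite lt_neqAle dot_ge0 andbT eq_sym; apply: contra v0.
  rewrite dotE psumr_eq0 => [/allP v0|i _]; last exact: sqr_ge0.
  apply/eqP/rowP => i; rewrite mxE; apply/eqP.
  by have := v0 i (mem_index_enum i); rewrite /= sqrf_eq0.
rewrite -(pmulr_lge0 _ v_gt0).
have := dot_ge0 _ (v *m A).
by rewrite trmx_mul mulmxA -(mulmxA v) vE -scalemxAl mxE.
Qed.

(** * Sums of squares and of square roots, with their equality cases *)

(** By induction: squaring [x] plus the remaining sum adds the cross term bounded in [xs], which
    vanishes exactly when [x] has zero product with every later element. *)
Lemma sum_sqr_leif (R : realDomainType) (s : seq R) : all (>= 0) s ->
  \sum_(x <- s) x ^+ 2 <= (\sum_(x <- s) x) ^+ 2
    ?= iff pairwise (fun x y => x * y == 0) s.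
Proof.
elim: s => [|x s IHs] /=; first by rewrite !big_nil expr0n; apply/leif_refl.
case/andP=> x0 s0; rewrite !big_cons sqrrD -addrA.
have xs : 0 <= x * (\sum_(y <- s) y) *+ 2 ?= iff all (fun y => x * y == 0) s.
  elim: s s0 {IHs} => [_|y s IHs /=/andP[y0 /IHs]].
    by rewrite big_nil mulr0 mul0rn; apply/leif_refl.
  have xy : 0 <= x * y *+ 2 ?= iff (x * y == 0).
    by split; rewrite ?mulrn_wge0 ?mulr_ge0 // eq_sym mulrn_eq0.
  by move/(leifD xy); rewrite addr0 big_cons mulrDr mulrnDl.
have xx : x ^+ 2 <= x ^+ 2 ?= iff true by apply/leif_refl.
by have := leifD xx (leifD xs (IHs s0)); rewrite add0r.
Qed.

(** The previous bound applied to the square roots. Its equality condition can be stated on [s]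
    itself, since the product of two roots is the root of the product; this links the energy to the
    trace of the squared Gram matrix. *)
Lemma sum_sqrt_leif (R : rcfType) (s : seq R) : all (>= 0) s ->
  \sum_(x <- s) x <= (\sum_(x <- s) Num.sqrt x) ^+ 2
    ?= iff pairwise (fun x y => x * y == 0) s.
Proof.
move=> s0; have := @sum_sqr_leif _ (map Num.sqrt s).
rewrite all_map (eq_all (_ : _ =1 xpredT)) ?all_predT; last first.
  by move=> x /=; rewrite sqrtr_ge0.
move/(_ isT); rewrite !big_map pairwise_map.
rewrite (eq_big_seq id) => [|x /(allP s0)/sqr_sqrtr //].
rewrite (eq_in_pairwise _ s0 (r' := fun x y => x * y == 0)) //.
move=> x y x0 y0 /=.
by rewrite -sqrtrM // sqrtr_eq0 [RHS]eq_le mulr_ge0 ?andbT.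
Qed.

(** * The Gram matrix of the Randić incidence matrix and its entries *)

Section RandicGram.
Variables (R : rcfType) (G : sgraph).
Implicit Types v w : G.

Lemma edge_endpoint v (e : {set G}) :
  e \in edges G -> v \in e -> exists2 w, adj v w & e = [set v; w].
Proof.
case/imsetP=> -[x y] /=; rewrite inE /= => xy -> /set2P[] ->; first by exists y.
by exists x; rewrite 1?adj_sym // setUC.
Qed.

Lemma mem_edges v w : adj v w -> [set v; w] \in edges G.
Proof. by move=> vw; apply/imsetP; exists (v, w); rewrite ?inE. Qed.

Lemma card_incident v : #|[set e in edges G | v \in e]| = deg v.
Proof.
rewrite /deg -(card_in_imset (f := fun w => [set v; w])); last first.
  (* Injectivity: [w] lies in [[set v; w']], and it differs from its neighbour [v] by
     irreflexivity. *)
  move=> w w'; rewrite !inE => vw _ /setP/(_ w); rewrite !inE eqxx orbT.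
  case: eqP vw => [->|_ _ /esym/eqP //]; by rewrite adj_irr.
congr #|pred_of_set _|; apply/setP => e; rewrite inE; apply/andP/imsetP.
  by case=> /edge_endpoint H /H[w vw ->]; exists w; rewrite ?inE.
by case=> w; rewrite inE => /mem_edges vw ->; rewrite vw !inE eqxx.
Qed.

(** The only edge that can contain two distinct vertices is the pair itself; the boolean [adj v w]
    is read as 0 or 1. *)
Lemma card_common_edges v w : v != w ->
  #|[set e in edges G | v \in e & w \in e]| = adj v w.
Proof.
move=> v_neq_w.
have eqe e : e \in edges G -> v \in e -> w \in e -> adj v w /\ e = [set v; w].
  move=> eG /(edge_endpoint eG)[x vx ->].
  by rewrite !inE eq_sym (negPf v_neq_w) => /eqP->.
case vw: (adj v w).
  rewrite -[RHS](cards1 [set v; w]); congr #|pred_of_set _|.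
  apply/setP => e; rewrite !inE; apply/and3P/eqP => [[eG ve we]|->].
    by case: (eqe e).
  by rewrite mem_edges // !inE !eqxx orbT.
apply/eqP; rewrite cards_eq0; apply/set0Pn => -[e].
by rewrite inE => /and3P[eG ve] /(eqe e eG ve)[]; rewrite vw.
Qed.

Let B := randic_incidence R G *m (randic_incidence R G)^T.

Lemma randic_gramE i j (v := enum_val i) (w := enum_val j) :
  B i j = #|[set e in edges G | v \in e & w \in e]|%:R
          / (Num.sqrt (deg v)%:R * Num.sqrt (deg w)%:R).
Proof.
rewrite mxE; under eq_bigr do rewrite !mxE.
pose F (e : {set G}) : R := (if v \in e then (Num.sqrt (deg v)%:R)^-1 else 0) *
  (if w \in e then (Num.sqrt (deg w)%:R)^-1 else 0).
rewrite -(big_enum_val F) -sum1_card natr_sum mulr_suml.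
(* Both sums are extended by zero to all vertex sets and compared term by term. *)
rewrite big_mkcond [RHS]big_mkcond; apply: eq_bigr => e _.
rewrite inE /F; case: (e \in edges G) => //=.
by do 2!case: ifP => //= _; rewrite ?mulr0 ?mul0r // mul1r invfM.
Qed.

Hypothesis no_isolated : forall v, ~~ isolated v.

Lemma deg_gt0 v : (0 < deg v)%N.
Proof.
have /forallPn[w] := no_isolated v; rewrite negbK => vw.
by apply/card_gt0P; exists w; rewrite inE.
Qed.

Lemma randic_gram_diag i : B i i = 1.
Proof.
rewrite randic_gramE -expr2 sqr_sqrtr ?ler0n //.
rewrite (_ : [set e in _ | _ & _] = [set e in edges G | enum_val i \in e]).
  by rewrite card_incident divff // pnatr_eq0 -lt0n deg_gt0.
by apply/setP => e; rewrite !inE andbb.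
Qed.

(** Off the diagonal the square is 0 or the inverse of the product of two positive degrees, so it
    reaches 1 only for adjacent vertices whose degrees are both 1. *)
Lemma randic_gram_sqr_leif i j (v := enum_val i) (w := enum_val j) :
  B i j ^+ 2 <= 1
    ?= iff (v == w) || [&& adj v w, deg v == 1%N & deg w == 1%N].
Proof.
rewrite /v /w (inj_eq enum_val_inj); have [->|ij] := eqVneq i j.
  by rewrite randic_gram_diag expr1n; apply/leif_refl.
rewrite randic_gramE card_common_edges ?(inj_eq enum_val_inj) //.
rewrite expr_div_n exprMn !sqr_sqrtr ?ler0n // -natrM -natrX.
have := deg_gt0 (enum_val i); have := deg_gt0 (enum_val j).
move: (deg _) (deg _) => d d' d0 d'0; rewrite -muln_eq1 mulnC.
case: adj; rewrite /= ?mul0r; last by apply/leifP; rewrite ltr01.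
rewrite mul1r; apply/leifP; case: eqP => [->|/eqP dd]; first by rewrite invr1.
rewrite invf_lt1 ?ltr0n ?muln_gt0 ?d0 // ltr1n.
by rewrite ltn_neqAle eq_sym dd muln_gt0 d0.
Qed.

Lemma trace_randic_gram : \tr B = #|G|%:R.
Proof.
rewrite /mxtrace (eq_bigr _ (fun i _ => randic_gram_diag i)).
by rewrite sumr_const card_ord.
Qed.

(** By symmetry of [B] the trace is the sum of the squared entries, each of which is compared with
    1. *)
Lemma trace_sqr_randic_gram_leif : \tr (B *m B) <= #|G|%:R ^+ 2
  ?= iff [forall v : G, forall w : G,
           (v == w) || [&& adj v w, deg v == 1%N & deg w == 1%N]].
Proof.
have Bsym i j : B^T i j = B i j by rewrite trmx_mul trmxK.
have -> : \tr (B *m B) = \sum_i \sum_j B i j ^+ 2.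
  apply: eq_bigr => i _; rewrite [LHS]mxE; apply: eq_bigr => j _.
  by rewrite expr2 -{2}Bsym [B^T _ _]mxE mulrC.
have -> : #|G|%:R ^+ 2 = \sum_(i < #|G|) \sum_(j < #|G|) (1 : R).
  by rewrite !sumr_const card_ord expr2 mulr_natl.
have := leif_sum (fun i _ => leif_sum (fun j _ => randic_gram_sqr_leif i j)).
move=> /(_ xpredT xpredT) H; congr (_ <= _ ?= iff _) : H.
apply/idP/idP.
  move=> H; apply/forallP => v; apply/forallP => w.
  have /forallP/(_ (enum_rank v))/forallP/(_ (enum_rank w)) := H.
  by rewrite !enum_rankK.
move/forallP=> H; apply/forallP => i /=; apply/forallP => j /=.
exact: (forallP (H _)).
Qed.

Lemma deg_complete : (forall v w, adj v w = (v != w)) ->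
  forall v, deg v = #|G|.-1.
Proof.
move=> adjE v; transitivity #|predC1 v|; last exact: cardC1.
by apply: eq_card => w; rewrite !inE adjE eq_sym.
Qed.

(** The condition makes the graph complete, so every degree is the order minus one; a vertex and one
    of its neighbours then have degree 1, which forces order 2. *)
Lemma perfect_complete_iso : (0 < #|G|)%N ->
  [forall v : G, forall w : G,
    (v == w) || [&& adj v w, deg v == 1%N & deg w == 1%N]] <->
  sg_iso G (complete_graph 2).
Proof.
move=> G0; split=> [/'forall_forallP H|[f fbij fadj]].
  have adjE v w : adj v w = (v != w).
    have [->|vw] := eqVneq v w; first exact: adj_irr.
    by have := H v w; rewrite (negPf vw) => /and3P[].
  have /card_gt0P[v _] := G0.
  have cG : #|G| = 2.
    have /forallPn[w] := no_isolated v; rewrite negbK => vw.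
    have := H v w; move: (vw); rewrite adjE => /negPf-> /and3P[_ /eqP].
    by rewrite deg_complete //; case: #|G| => // -[//|n] [->].
  exists (fun x => cast_ord cG (enum_rank x)).
    exists (fun i => enum_val (cast_ord (esym cG) i)) => x.
      by rewrite cast_ordK enum_rankK.
    by rewrite enum_valK cast_ordKV.
  move=> x y; rewrite adjE /= (inj_eq (@cast_ord_inj _ _ _)).
  by rewrite (inj_eq enum_rank_inj).
have adjE v w : adj v w = (v != w).
  by rewrite -fadj /= (inj_eq (bij_inj fbij)).
have degE v : deg v = 1%N.
  by rewrite deg_complete // (bij_eq_card fbij) card_ord.
by apply/'forall_forallP => v w; rewrite adjE !degE andbT orbN.
Qed.

End RandicGram.

Theorem theorem2p1 (R : rcfType) (G : sgraph) (n : nat)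
    (order_G : #|G| = n) (n_gt0 : (0 < n)%N)
    (no_isolated : forall v : G, ~~ isolated v) :
  Num.sqrt n%:R <= randic_incidence_energy R G /\
  (randic_incidence_energy R G = Num.sqrt n%:R <->
   sg_iso G (complete_graph 2)).
Proof.
subst n; set E := randic_incidence_energy R G.
pose B := randic_incidence R G *m (randic_incidence R G)^T.
have Bsym : B^T = B by rewrite trmx_mul trmxK.
have [s [sP trB trBB]] := symmetric_spectrum Bsym.
have s0 : all (>= 0) s.
  apply/allP => a; rewrite -root_prod_XsubC -sP; exact: gram_eigenvalue_ge0.
have EE : E = \sum_(a <- s) Num.sqrt a.
  rewrite /E /randic_incidence_energy big_map.
  exact: perm_big (perm_eigenvalues sP).
have E0 : 0 <= E by rewrite EE sumr_ge0 // => a _; exact: sqrtr_ge0.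
have := sum_sqrt_leif s0; rewrite -EE trB trace_randic_gram // => leE.
have := sum_sqr_leif s0; rewrite trB trBB trace_randic_gram // => leBB.
have eqBB := trace_sqr_randic_gram_leif R no_isolated.
(* Both sides are nonnegative, so equality can be tested on squares. *)
have En : (E == Num.sqrt #|G|%:R) = (#|G|%:R == E ^+ 2).
  by rewrite -(@eqrXn2 _ 2) ?sqrtr_ge0 // sqr_sqrtr ?ler0n // eq_sym.
split; first by rewrite -(ger0_norm E0) -sqrtr_sqr ler_wsqrtr // leE.
(* The vanishing of all pairwise products of eigenvalues is the common equality case that joins the
   trace condition to the energy condition. *)
rewrite -(perfect_complete_iso no_isolated n_gt0) -eqBB.2 leBB.2 -leE.2 -En.
by split=> [->|/eqP].
Qed.
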